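(* Let $(X,d,\alpha)$ be a computable metric space and let $(Y,\mathcal{S},(B_i)_{i\in\mathbb{N}})$ be its pseudocompactification. Then $(Y,\mathcal{S},(B_i))$ is a computable topological space.
   Context: A computable metric space $(X,d,\alpha)$ is a metric space with a dense sequence $(\alpha_i)$ such that $(i,j)\mapsto d(\alpha_i,\alpha_j)$ is computable (approximable by a computable rational-valued $F(i,j,k)$ to within $2^{-k}$). Fix computable $q:\mathbb{N}\to\mathbb{Q}$ onto the positive rationals and computable $\tau_1,\tau_2$ with $\{(\tau_1(i),\tau_2(i))\}=\mathbb{N}^2$; let $\lambda_i=\alpha_{\tau_1(i)}$, $\rho_i=q_{\tau_2(i)}$, $I_i=B(\lambda_i,\rho_i)$ (open ball), $\hat I_i=\{y\in X: d(y,\lambda_i)\le\rho_i\}$. The pseudocompactification: $Y=X\cup\{\infty\}$ with $\infty\notin X$, $\mathcal{S}=\mathcal{T}_d\cup\{\{\infty\}\cup U: U$ open in $(X,d)$ and $X\setminus U$ bounded in $(X,d)\}$ where $\mathcal{T}_d$ is the metric topology, and $B_i=I_{i/2}$ if $i$ is even, $B_i=\{\infty\}\cup(X\setminus\hat I_{(i-1)/2})$ if $i$ is odd. A computable topological space is a triple $(Y,\mathcal{S},(B_i))$ with $\{B_i\}\subseteq\mathcal{S}$ a basis of the topology $\mathcal{S}$ and c.e. sets $\mathcal{C},\mathcal{D}\subseteq\mathbb{N}^2$ such that: (1) $(i,j)\in\mathcal{D}\Rightarrow B_i\cap B_j=\emptyset$; (2) $(i,j)\in\mathcal{C}\Rightarrow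 B_i\subseteq B_j$; (3) for $x\neq y$ in $Y$ there are $i,j$ with $x\in B_i$, $y\in B_j$, $(i,j)\in\mathcal{D}$; (4) if $x\in B_i\cap B_j$ there is $k$ with $x\in B_k$ and $(k,i),(k,j)\in\mathcal{C}$. *)

(* Defs.v *)
From HB Require Import structures.
From mathcomp Require Import all_boot all_order all_algebra.
From mathcomp Require Import all_classical all_reals all_analysis.

Set Implicit Arguments.
Unset Strict Implicit.
Unset Printing Implicit Defensive.

Import Order.TTheory GRing.Theory Num.Theory.

Local Open Scope classical_set_scope.
Local Open Scope ring_scope.

(* The total recursive functions nat^n -> nat: minimization is only applied to
   functions [g] with a zero on every fibre, and [f v] is the least such zero. *)
Inductive recursive : forall n : nat, (n.-tuple nat -> nat) -> Prop :=
| rec_zero n : @recursive n (fun=> 0%N)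
| rec_succ : @recursive 1 (fun v => (thead v).+1)
| rec_proj n (i : 'I_n) : @recursive n (fun v => tnth v i)
| rec_comp m n (g : m.-tuple nat -> nat) (h : 'I_m -> n.-tuple nat -> nat) :
    recursive g -> (forall i, recursive (h i)) ->
    @recursive n (fun v => g [tuple h i v | i < m])
| rec_primrec n (g : n.-tuple nat -> nat) (h : n.+2.-tuple nat -> nat) :
    recursive g -> recursive h ->
    @recursive n.+1 (fun v =>
      let w := [tuple of behead v] in
      nat_rec (fun=> nat) (g w) (fun k r => h [tuple of k :: r :: w]) (thead v))
| rec_mu n (g : n.+1.-tuple nat -> nat) (f : n.-tuple nat -> nat) :
    recursive g ->
    (forall v, g [tuple of f v :: v] = 0%N) ->
    (forall v m, (m < f v)%N -> g [tuple of m :: v] <> 0%N) ->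
    @recursive n f.

Definition computable_nat (f : nat -> nat) : Prop :=
  @recursive 1 (fun v => f (thead v)).

Definition computable_ratfun (n : nat) (F : n.-tuple nat -> rat) : Prop :=
  exists a b c : n.-tuple nat -> nat,
    [/\ recursive a, recursive b, recursive c &
        forall v, F v = (-1) ^+ c v * ((a v)%:R / (b v).+1%:R)].

Definition computable_rat (q : nat -> rat) : Prop :=
  @computable_ratfun 1 (fun v => q (thead v)).

Definition ce2 (A : set (nat * nat)) : Prop :=
  A = set0 \/
  exists f g : nat -> nat,
    [/\ computable_nat f, computable_nat g & A = range (fun n => (f n, g n))].

Definition computable_metric_space (R : realType) (X : metricType R)
    (alpha : nat -> X) : Prop :=
  dense (range alpha) /\
  exists F : 3.-tuple nat -> rat,
    computable_ratfun F /\
    forall i j k : nat,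
      `|mdist (alpha i) (alpha j) - ratr (F [tuple i; j; k])| < 2 ^- k.

Definition is_topology (Y : Type) (S : set (set Y)) : Prop :=
  [/\ S setT,
      forall A B, S A -> S B -> S (A `&` B) &
      forall G : set (set Y), G `<=` S -> S (\bigcup_(A in G) A)].

Definition is_basis (Y : Type) (S : set (set Y)) (B : nat -> set Y) : Prop :=
  range B `<=` S /\
  forall U, S U -> exists J : set nat, U = \bigcup_(i in J) B i.

Definition computable_topological_space (Y : Type) (S : set (set Y))
    (B : nat -> set Y) : Prop :=
  [/\ is_topology S, is_basis S B &
    exists C D : set (nat * nat),
      [/\ ce2 C, ce2 D,
          forall i j, D (i, j) -> B i `&` B j = set0 &
          forall i j, C (i, j) -> B i `<=` B j] /\
      [/\ forall x y : Y, x <> y ->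
            exists i j, [/\ B i x, B j y & D (i, j)] &
          forall (x : Y) i j, B i x -> B j x ->
            exists k, [/\ B k x, C (k, i) & C (k, j)]]].

Definition metric_bounded (R : realType) (X : metricType R) (A : set X) : Prop :=
  exists (x : X) (r : R), A `<=` ball x r.

Section Pseudocompactification.
Variables (R : realType) (X : metricType R).

(* The carrier is [option X], with [None] the point at infinity. *)
Definition pseudocompact_open : set (set (option X)) :=
  [set Some @` U | U in open] `|`
  [set None |` Some @` U | U in [set U : set X | open U /\ metric_bounded (~` U)]].

Variables (alpha : nat -> X) (q : nat -> rat) (tau1 tau2 : nat -> nat).

Definition lambda_ (i : nat) : X := alpha (tau1 i).
Definition rho_ (i : nat) : R := ratr (q (tau2 i)).

Definition rational_ball (i : nat) : set X := ball (lambda_ i) (rho_ i).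
Definition rational_cball (i : nat) : set X :=
  [set y | mdist y (lambda_ i) <= rho_ i].

Definition pseudocompact_basis (i : nat) : set (option X) :=
  if odd i then None |` Some @` (~` rational_cball i.-1./2)
  else Some @` rational_ball i./2.

End Pseudocompactification.

Arguments pseudocompact_open {R} X.

(* Main.v *)
Require Import Defs.
From mathcomp Require Import all_boot all_order all_algebra.
From mathcomp Require Import all_classical all_reals all_analysis.
From mathcomp Require Import zify ring lra.

Set Implicit Arguments.
Unset Strict Implicit.
Unset Printing Implicit Defensive.

Import Order.TTheory GRing.Theory Num.Theory.

Local Open Scope classical_set_scope.
Local Open Scope ring_scope.

(* Inclusion and disjointness of basic sets are replaced by strict inequalities
   between centres and radii: [d(l_i, l_j) + r_i < r_j] (formal inclusion of
   balls) and [r_i + r_j < d(l_i, l_j)] (formal disjointness). Complementing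
   closed balls exchanges the two relations, so they also serve the
   neighbourhoods of infinity. Being strict, they leave room for small balls
   around a point of X, respectively large balls around a bounded set; and a
   strict inequality between an approximable real and a rational is witnessed by
   some finite precision [k], so the relations are projections of decidable
   relations. *)

(** * Closure properties of recursive functions *)

Lemma eq_recursive n (f g : n.-tuple nat -> nat) :
  f =1 g -> recursive f -> recursive g.
Proof. by move=> /funext ->. Qed.

(** Composition with [a] in the first slot and projections in the others. It lets a recursion bound
    be computed from the parameters. *)
Lemma recursive_cons n (f : n.+1.-tuple nat -> nat) (a : n.-tuple nat -> nat) :
  recursive f -> recursive a -> recursive (fun v => f [tuple of a v :: v]).
Proof.
move=> rf ra.
pose h (i : 'I_n.+1) (v : n.-tuple nat) := tnth [tuple of a v :: v] i.
have rh i : recursive (h i).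
  case: (unliftP ord0 i) => [j|] ->.
    by apply: eq_recursive (rec_proj j) => v; rewrite /h tnthS.
  by apply: eq_recursive ra => v; rewrite /h tnth0.
apply: eq_recursive (rec_comp rf rh) => v; congr f.
by apply: eq_from_tnth => i; rewrite tnth_mktuple.
Qed.

Lemma recursive_app1 n (f : nat -> nat) (h : n.-tuple nat -> nat) :
  computable_nat f -> recursive h -> recursive (fun v => f (h v)).
Proof.
move=> rf rh; apply: eq_recursive (rec_comp rf (fun=> rh)) => v.
by rewrite /thead tnth_mktuple.
Qed.

Lemma recursive_app3 n (f : 3.-tuple nat -> nat)
    (h1 h2 h3 : n.-tuple nat -> nat) :
  recursive f -> recursive h1 -> recursive h2 -> recursive h3 ->
  recursive (fun v => f [tuple h1 v; h2 v; h3 v]).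
Proof.
move=> rf r1 r2 r3; pose h := tnth [tuple h1; h2; h3].
have rh i : recursive (h i) by case: i => [[|[|[|]]]].
apply: eq_recursive (rec_comp rf rh) => v; congr f.
apply: eq_from_tnth => i; rewrite tnth_mktuple /h.
by case: i => [[|[|[|]]]].
Qed.

(** Weakening: the step function of a primitive recursion also receives the counter and the
    accumulator, which [f] must ignore. *)
Lemma recursive_behead2 n (f : n.-tuple nat -> nat) : recursive f ->
  @recursive n.+2 (fun w => f [tuple of behead [tuple of behead w]]).
Proof.
move=> rf.
have rh (i : 'I_n) : @recursive n.+2 (fun w => tnth w (lift ord0 (lift ord0 i))).
  exact: rec_proj.
apply: eq_recursive (rec_comp rf rh) => w; congr f.
by apply: eq_from_tnth => i; rewrite tnth_mktuple !tnth_behead; congr tnth;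
  apply/val_inj; rewrite /= !inordK ?ltnS.
Qed.

(** [rec_primrec] recurses on the head of its tuple; putting [a v] there gives the form from which
    the arithmetic functions below are built. *)
Lemma recursive_nat_rec n (g a : n.-tuple nat -> nat)
    (h : n.+2.-tuple nat -> nat) :
  recursive g -> recursive h -> recursive a ->
  recursive (fun v => nat_rec (fun=> nat) (g v)
    (fun k r => h [tuple of k :: r :: v]) (a v)).
Proof.
move=> rg rh ra.
apply: eq_recursive (recursive_cons (rec_primrec rg rh) ra) => v.
(* The tail of [a v :: v] is [v] only up to its length proof, hence the detour through an arbitrary
   [w] equal to [v]. *)
have E (w : n.-tuple nat) k : w = v ->
    nat_rec (fun=> nat) (g w) (fun k r => h [tuple of k :: r :: w]) k =
    nat_rec (fun=> nat) (g v) (fun k r => h [tuple of k :: r :: v]) k.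
  by move=> ->.
by rewrite theadE; apply: E; exact: val_inj.
Qed.

Lemma recursive_const n (c : nat) : @recursive n (fun=> c).
Proof.
elim: c => [|c IH]; first exact: rec_zero.
exact: (recursive_app1 rec_succ IH).
Qed.

Lemma recursive_succ n (f : n.-tuple nat -> nat) :
  recursive f -> recursive (fun v => (f v).+1).
Proof. exact/recursive_app1/rec_succ. Qed.

Lemma recursive_pred n (f : n.-tuple nat -> nat) :
  recursive f -> recursive (fun v => (f v).-1).
Proof.
(* The step returns the counter and discards the accumulator; the base value 0 gives the predecessor
   of 0. *)
move=> rf; have r0 := rec_proj (ord0 : 'I_n.+2).
apply: eq_recursive (recursive_nat_rec (rec_zero n) r0 rf) => v.
by case: (f v).
Qed.

Lemma recursive_add n (f g : n.-tuple nat -> nat) :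
  recursive f -> recursive g -> recursive (fun v => (f v + g v)%N).
Proof.
move=> rf rg.
have rh := recursive_succ (rec_proj (lift ord0 ord0 : 'I_n.+2)).
apply: eq_recursive (recursive_nat_rec rg rh rf) => v.
by elim: (f v) => //= k ->; rewrite addSn.
Qed.

Lemma recursive_sub n (f g : n.-tuple nat -> nat) :
  recursive f -> recursive g -> recursive (fun v => (f v - g v)%N).
Proof.
move=> rf rg.
have rh := recursive_pred (rec_proj (lift ord0 ord0 : 'I_n.+2)).
apply: eq_recursive (recursive_nat_rec rf rh rg) => v.
by elim: (g v) => [|k] /=; rewrite ?subn0// => ->; rewrite subnS.
Qed.

Lemma recursive_mul n (f g : n.-tuple nat -> nat) :
  recursive f -> recursive g -> recursive (fun v => (f v * g v)%N).
Proof.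
move=> rf rg.
have rh := recursive_add (recursive_behead2 rg)
  (rec_proj (lift ord0 ord0 : 'I_n.+2)).
apply: eq_recursive (recursive_nat_rec (rec_zero n) rh rf) => v.
elim: (f v) => //= k ->; rewrite mulSn; congr (g _ + _)%N.
exact: val_inj.
Qed.

Lemma recursive_exp2 n (f : n.-tuple nat -> nat) :
  recursive f -> recursive (fun v => (2 ^ f v)%N).
Proof.
move=> rf.
have r1 := rec_proj (lift ord0 ord0 : 'I_n.+2).
have rh := recursive_add r1 r1.
apply: eq_recursive (recursive_nat_rec (recursive_const n 1) rh rf) => v.
by elim: (f v) => //= k ->; rewrite /tnth /= addnn expnS mul2n.
Qed.

Lemma recursive_odd n (f : n.-tuple nat -> nat) :
  recursive f -> recursive (fun v => odd (f v) : nat).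
Proof.
move=> rf.
have rh := recursive_sub (recursive_const _ 1)
  (rec_proj (lift ord0 ord0 : 'I_n.+2)).
apply: eq_recursive (recursive_nat_rec (rec_zero n) rh rf) => v.
by elim: (f v) => //= k ->; rewrite /tnth /=; case: odd.
Qed.

Lemma recursive_half n (f : n.-tuple nat -> nat) :
  recursive f -> recursive (fun v => (f v)./2).
Proof.
move=> rf.
(* The half grows by one exactly when the counter passes an odd number. *)
have rh := recursive_add (recursive_odd (rec_proj (ord0 : 'I_n.+2)))
  (rec_proj (lift ord0 ord0 : 'I_n.+2)).
apply: eq_recursive (recursive_nat_rec (rec_zero n) rh rf) => v.
by elim: (f v) => //= k ->; rewrite /tnth /= uphalf_half.
Qed.

(** * Decidable and computably enumerable sets *)

Definition recursive_bool n (p : n.-tuple nat -> bool) : Prop :=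
  recursive (fun v => p v : nat).

Lemma recursive_boolN n (p : n.-tuple nat -> bool) :
  recursive_bool p -> recursive_bool (fun v => ~~ p v).
Proof.
move=> rp; apply: eq_recursive (recursive_sub (recursive_const n 1) rp) => v.
by case: (p v).
Qed.

Lemma recursive_boolI n (p r : n.-tuple nat -> bool) :
  recursive_bool p -> recursive_bool r -> recursive_bool (fun v => p v && r v).
Proof.
move=> rp rr; apply: eq_recursive (recursive_mul rp rr) => v.
by rewrite mulnb.
Qed.

(** With truncated subtraction, [1 - (1 - (g - f))] is the characteristic function of [f < g]. *)
Lemma recursive_ltn n (f g : n.-tuple nat -> nat) :
  recursive f -> recursive g -> recursive_bool (fun v => (f v < g v)%N).
Proof.
move=> rf rg; rewrite /recursive_bool.
have r1 := recursive_const n 1.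
apply: eq_recursive (recursive_sub r1 (recursive_sub r1 (recursive_sub rg rf))).
by move=> v; lia.
Qed.

Lemma recursive_if n (p : n.-tuple nat -> bool) (f g : n.-tuple nat -> nat) :
  recursive_bool p -> recursive f -> recursive g ->
  recursive (fun v => if p v then f v else g v).
Proof.
move=> rp rf rg.
apply: eq_recursive (recursive_add (recursive_mul rp rf)
  (recursive_mul (recursive_boolN rp) rg)) => v.
by case: (p v) => /=; lia.
Qed.

Lemma recursive_bool_if n (p r s : n.-tuple nat -> bool) :
  recursive_bool p -> recursive_bool r -> recursive_bool s ->
  recursive_bool (fun v => if p v then r v else s v).
Proof.
move=> rp rr rs; apply: eq_recursive (recursive_if rp rr rs) => v.
by case: (p v).
Qed.

(* The surjection onto pairs is iterated to enumerate all triples. *)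
Lemma ce2_exists (tau1 tau2 : nat -> nat) (P : 3.-tuple nat -> bool) :
  computable_nat tau1 -> computable_nat tau2 ->
  range (fun i : nat => (tau1 i, tau2 i)) = [set: nat * nat] ->
  recursive_bool P ->
  ce2 [set ij | exists k, P [tuple ij.1; ij.2; k]].
Proof.
move=> c1 c2 tau_onto rP; set A := [set _ | _].
(* A member [(a, b)] serves as default output for triples failing the test, which keeps the
   enumeration total; the empty set is therefore treated apart. *)
have [->|/set0P[[a b] Aab]] := eqVneq A set0; [by left|right].
pose t1 := tau1; pose t2 n := tau1 (tau2 n); pose t3 n := tau2 (tau2 n).
have r1 : computable_nat t1 by [].
have r2 : computable_nat t2 := recursive_app1 c1 c2.
have r3 : computable_nat t3 := recursive_app1 c2 c2.
pose p n := P [tuple t1 n; t2 n; t3 n].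
have rp : @recursive_bool 1 (fun v => p (thead v)) := recursive_app3 rP r1 r2 r3.
exists (fun n => if p n then t1 n else a), (fun n => if p n then t2 n else b).
split.
- exact: recursive_if rp r1 (recursive_const _ a).
- exact: recursive_if rp r2 (recursive_const _ b).
apply/seteqP; split => [[i j] [k /= Pijk]|_ [n _ <-]].
  have [m _ [m1 m2]] : range (fun i : nat => (tau1 i, tau2 i)) (j, k).
    by rewrite tau_onto.
  have [n _ [n1 n2]] : range (fun i : nat => (tau1 i, tau2 i)) (i, m).
    by rewrite tau_onto.
  exists n => //; have -> : p n by rewrite /p /t1 /t2 /t3 n1 n2 m1 m2.
  by rewrite /t1 /t2 n1 n2 m1.
by case: ifPn => // pn; exists (t3 n).
Qed.

(** * Rational-valued recursive functions *)

(* Differences of naturals over a common denominator are closed under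
   sums and opposites without any case distinction on signs. *)
Definition recursive_rat n (F : n.-tuple nat -> rat) : Prop :=
  exists a b c : n.-tuple nat -> nat,
    [/\ recursive a, recursive b, recursive c &
        forall v, F v = ((a v)%:R - (b v)%:R) / (c v).+1%:R].

(** The parity of the sign exponent decides which of the two numerators receives [a]; the other is
    0. *)
Lemma computable_ratfun_recursive n (F : n.-tuple nat -> rat) :
  computable_ratfun F -> recursive_rat F.
Proof.
move=> [a [b [c [ra rb rc FE]]]].
pose pc v := odd (c v).
have rp : recursive_bool pc := recursive_odd rc.
exists (fun v => if ~~ pc v then a v else 0%N),
  (fun v => if pc v then a v else 0%N), b; split=> //.
- exact: recursive_if (recursive_boolN rp) ra (rec_zero _).
- exact: recursive_if rp ra (rec_zero _).
move=> v; rewrite FE -signr_odd -/(pc v).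
by case: (pc v) => /=; rewrite ?expr1 ?expr0 ?sub0r ?subr0 ?mul1r ?mulN1r ?mulNr.
Qed.

Lemma recursive_ratD n (F G : n.-tuple nat -> rat) :
  recursive_rat F -> recursive_rat G -> recursive_rat (fun v => F v + G v).
Proof.
move=> [a [b [c [ra rb rc FE]]]] [a' [b' [c' [ra' rb' rc' GE]]]].
exists (fun v => a v * (c' v).+1 + a' v * (c v).+1)%N,
  (fun v => b v * (c' v).+1 + b' v * (c v).+1)%N,
  (* The encoding stores a denominator minus one, so the product of the two denominators is lowered
     by one. *)
  (fun v => ((c v).+1 * (c' v).+1).-1)%N; split.
- by apply: recursive_add; apply: recursive_mul => //; exact: recursive_succ.
- by apply: recursive_add; apply: recursive_mul => //; exact: recursive_succ.
- by apply: recursive_pred; apply: recursive_mul; exact: recursive_succ.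
move=> v; rewrite FE GE prednK// !natrD !natrM.
have c0 : (c v).+1%:R != 0 :> rat by rewrite pnatr_eq0.
have c'0 : (c' v).+1%:R != 0 :> rat by rewrite pnatr_eq0.
by move: ((c v).+1%:R) ((c' v).+1%:R) c0 c'0 => x y x0 y0; field; rewrite x0 y0.
Qed.

Lemma recursive_ratN n (F : n.-tuple nat -> rat) :
  recursive_rat F -> recursive_rat (fun v => - F v).
Proof.
move=> [a [b [c [ra rb rc FE]]]]; exists b, a, c; split=> // v.
by rewrite FE -mulNr opprB.
Qed.

Lemma recursive_rat_exp2V n (f : n.-tuple nat -> nat) :
  recursive f -> recursive_rat (fun v => 2 ^- f v).
Proof.
move=> rf; exists (fun=> 1%N), (fun=> 0%N), (fun v => (2 ^ f v).-1); split.
- exact: recursive_const.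
- exact: recursive_const.
- exact/recursive_pred/recursive_exp2.
by move=> v; rewrite prednK ?expn_gt0// subr0 mul1r natrX.
Qed.

(** The denominator is positive, so the sign is decided by comparing the two natural numerators. *)
Lemma recursive_rat_gt0 n (F : n.-tuple nat -> rat) :
  recursive_rat F -> recursive_bool (fun v => 0 < F v).
Proof.
move=> [a [b [c [ra rb rc FE]]]].
apply: eq_recursive (recursive_ltn rb ra) => v.
by rewrite FE pmulr_lgt0 ?invr_gt0// subr_gt0 ltr_nat.
Qed.

Lemma recursive_rat_app1 n (q : nat -> rat) (f : n.-tuple nat -> nat) :
  computable_rat q -> recursive f -> recursive_rat (fun v => q (f v)).
Proof.
move=> /computable_ratfun_recursive[a [b [c [ra rb rc qE]]]] rf.
exists (fun v => a [tuple f v]), (fun v => b [tuple f v]), (fun v => c [tuple f v]).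
have r1 (g : 1.-tuple nat -> nat) : recursive g -> recursive (fun v => g [tuple f v]).
  move=> rg; apply: eq_recursive (rec_comp rg (fun=> rf)) => v; congr g.
  by apply: eq_from_tnth => i; rewrite tnth_mktuple (ord1 i).
split; [exact: r1..|].
by move=> v; rewrite -qE.
Qed.

Lemma recursive_rat_app3 n (F : 3.-tuple nat -> rat)
    (f g h : n.-tuple nat -> nat) :
  computable_ratfun F -> recursive f -> recursive g -> recursive h ->
  recursive_rat (fun v => F [tuple f v; g v; h v]).
Proof.
move=> /computable_ratfun_recursive[a [b [c [ra rb rc FE]]]] rf rg rh.
exists (fun v => a [tuple f v; g v; h v]), (fun v => b [tuple f v; g v; h v]),
  (fun v => c [tuple f v; g v; h v]).
by split; [exact: recursive_app3..|].
Qed.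

(** * Comparison of approximable reals with rationals *)

Lemma ex_exp2V_lt (R : realType) (e : R) : 0 < e -> exists k, 2 ^- k < e.
Proof.
move=> e0; exists (Num.bound e^-1).
by rewrite invf_plt ?posrE ?exprn_gt0//; exact: upper_nthrootP.
Qed.

Lemma approx_ltP (R : realType) (x : R) (G : nat -> rat) (s : rat) :
  (forall k, `|x - ratr (G k)| < 2 ^- k) ->
  x < ratr s <-> exists k, 0 < s - G k - 2 ^- k.
Proof.
move=> Gx.
have E k : (0 < s - G k - 2 ^- k) = (ratr (G k) + 2 ^- k < ratr s :> R).
  rewrite -[RHS]subr_gt0 -(@ltr_rat R) rmorph0 !rmorphB /= fmorphV rmorphXn /=.
  by rewrite ratr_nat opprD addrA.
split=> [xs|[k]].
  (* The gap is halved because the error [2 ^- k] enters twice: in the approximation [G k] and in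
     the test itself. *)
  have [k ke] := @ex_exp2V_lt R ((ratr s - x) / 2) ltac:(lra).
  by exists k; rewrite E; have := Gx k; rewrite ltr_norml => /andP[]; lra.
by rewrite E; have := Gx k; rewrite ltr_norml => /andP[]; lra.
Qed.

Lemma approx_gtP (R : realType) (x : R) (G : nat -> rat) (s : rat) :
  (forall k, `|x - ratr (G k)| < 2 ^- k) ->
  ratr s < x <-> exists k, 0 < G k - s - 2 ^- k.
Proof.
move=> Gx; rewrite -ltrN2 -rmorphN (@approx_ltP _ _ (fun k => - G k)).
  by split=> -[k] kP; exists k; move: kP; rewrite opprK [- s + _]addrC.
by move=> k; rewrite rmorphN /= -opprD normrN.
Qed.

(** * The topology of the pseudocompactification *)

Section topology.
Variables (R : realType) (X : metricType R).
Implicit Types (x y z : X) (A : set (option X)).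

(** Both families of open sets are described at once by the trace on [X] and a condition at
    infinity. Preimages commute with unions and intersections, so the topology axioms reduce to
    facts about traces. *)
Lemma pseudocompact_openP A : pseudocompact_open X A <->
  open (Some @^-1` A) /\ (A None -> metric_bounded (~` (Some @^-1` A))).
Proof.
have E (U : set X) : Some @^-1` (Some @` U) = U.
  by apply/seteqP; split=> [x [y Uy [<-]]//|x Ux]; exists x.
split=> [[[U oU <-]|[U [oU bU] <-]]|[oA bA]].
- by rewrite E; split=> // -[].
- have -> : Some @^-1` (None |` Some @` U) = U.
    by rewrite preimage_setU E; apply/seteqP; split=> [x [[]|]//|x]; right.
  by split.
have [AN|AN] := pselect (A None).
  right; exists (Some @^-1` A); first by split=> //; exact: bA.
  apply/seteqP; split=> [_ [->//|[x Ax <-]//]|[x|] Ax]; last by left.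
  by right; exists x.
left; exists (Some @^-1` A) => //.
by apply/seteqP; split=> [_ [x Ax <-]//|[x|]// Ax]; exists x.
Qed.

Lemma metric_boundedU (A B : set X) :
  metric_bounded A -> metric_bounded B -> metric_bounded (A `|` B).
Proof.
move=> [x [r Ar]] [y [s Bs]]; exists x, (Num.max r (mdist x y + s)) => z.
rewrite ballEmdist /= lt_max => -[/Ar|/Bs]; rewrite ballEmdist /= => h.
  by rewrite h.
by apply/orP; right; have := metric_triangle x y z; lra.
Qed.

Lemma metric_boundedS (A B : set X) :
  A `<=` B -> metric_bounded B -> metric_bounded A.
Proof. by move=> AB [x [r Br]]; exists x, r; exact: subset_trans AB Br. Qed.

Lemma pseudocompact_open_topology (x0 : X) : is_topology (pseudocompact_open X).
Proof.
split.
- apply/pseudocompact_openP; rewrite preimage_setT; split; first exact: openT.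
  (* Even the empty set needs a centre to be bounded, which is what [x0] provides. *)
  by move=> _; rewrite setCT; exists x0, 0.
- move=> A B /pseudocompact_openP[oA bA] /pseudocompact_openP[oB bB].
  apply/pseudocompact_openP; rewrite preimage_setI setCI.
  split=> [|[/bA ? /bB ?]]; [exact: openI|exact: metric_boundedU].
- move=> G GS; apply/pseudocompact_openP; rewrite preimage_bigcup; split.
    by apply: bigcup_open => A /GS /pseudocompact_openP[].
  (* One member containing infinity suffices: the complement of the union lies in its complement. *)
  move=> [A GA AN]; have /pseudocompact_openP[_ /(_ AN)] := GS _ GA.
  by apply: metric_boundedS; apply: subsetC => x Ax; exists A.
Qed.

Lemma mdist_open_lt x (r : R) : open [set y | mdist y x < r].
Proof.
rewrite openE => y /= yr; apply/nbhs_ballP; exists (r - mdist y x) => /=.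
  by rewrite subr_gt0.
move=> z; rewrite ballEmdist /= => yz.
by have := metric_triangle z y x; rewrite (metric_sym z y); lra.
Qed.

Lemma mdist_open_gt x (r : R) : open [set y | r < mdist y x].
Proof.
rewrite openE => y /= yr; apply/nbhs_ballP; exists (mdist y x - r) => /=.
  by rewrite subr_gt0.
move=> z; rewrite ballEmdist /= => yz.
by have := metric_triangle y z x; lra.
Qed.

End topology.

(** * Rational balls and the basis of the pseudocompactification *)

Section basis.
Variables (R : realType) (X : metricType R) (alpha : nat -> X) (q : nat -> rat).
Variables tau1 tau2 : nat -> nat.
Hypothesis alpha_dense : dense (range alpha).
Hypothesis q_onto : range q = [set r : rat | 0 < r].
Hypothesis tau_onto : range (fun i : nat => (tau1 i, tau2 i)) = [set: nat * nat].

Notation lam := (lambda_ alpha tau1).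
Notation rho := (rho_ R q tau2).
Notation B := (pseudocompact_basis alpha q tau1 tau2).

Lemma pseudocompact_basis_None i : B i None <-> odd i.
Proof.
rewrite /pseudocompact_basis; case: (odd i); split=> //; first by left.
by case.
Qed.

(** Both parities can use the index [i./2], and both conditions are strict, since odd indices remove
    a closed ball. Later arguments about finite points use only these inequalities. *)
Lemma pseudocompact_basis_Some i x : B i (Some x) <->
  if odd i then rho i./2 < mdist x (lam i./2) else mdist x (lam i./2) < rho i./2.
Proof.
rewrite /pseudocompact_basis; have [oi|ei] := boolP (odd i).
  have -> : i.-1./2 = i./2 by lia.
  rewrite /rational_cball; split=> [[//|[y /= yr [<-]]]|xr].
    by rewrite ltNge; apply/negP.
  by right; exists x => //=; rewrite leNgt xr.
rewrite /rational_ball ballEmdist /= metric_sym; split=> [[y yr [<-]//]|xr].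
by exists x.
Qed.

Lemma ex_rational_ball n (r : rat) : 0 < r ->
  exists i, lam i = alpha n /\ rho i = ratr r.
Proof.
move=> r0; have [m _ mE] : range q r by rewrite q_onto.
have [i _ [i1 i2]] : range (fun i : nat => (tau1 i, tau2 i)) (n, m).
  by rewrite tau_onto.
by exists i; rewrite /lambda_ /rho_ i1 i2 mE.
Qed.

(** A rational radius is chosen between 0 and [e], then density gives a centre closer to [x] than
    this radius. *)
Lemma ex_small_rational_ball x (e : R) : 0 < e ->
  exists i, mdist x (lam i) < rho i /\ rho i < e.
Proof.
move=> e0; have [r] := rat_in_itvoo e0.
rewrite in_itv /= => /andP[r0 re].
have r0' : 0 < r by rewrite ltr0q in r0.
have [||y [yx [n _ nE]]] := alpha_dense (O := [set y | mdist y x < ratr r]).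
- by exists x; rewrite /= mdistxx.
- exact: mdist_open_lt.
have [i [i1 i2]] := ex_rational_ball n r0'.
by exists i; rewrite i1 i2 metric_sym nE.
Qed.

Lemma ex_large_rational_ball x (M : R) :
  exists i, mdist x (lam i) + M < rho i.
Proof.
(* The centre [alpha 0] is fixed and only the radius grows; the maximum with 0 keeps it positive, as
   [q] takes only positive values. *)
have h : Num.max 0 (mdist x (alpha 0%N) + M) <
    Num.max 0 (mdist x (alpha 0%N) + M) + 1 by lra.
have [r] := rat_in_itvoo h.
rewrite in_itv /= gt_max => /andP[/andP[r0 re] _].
rewrite ltr0q in r0.
by have [i [i1 i2]] := ex_rational_ball 0 r0; exists i; rewrite i1 i2.
Qed.

Lemma rho_gt0 i : 0 < rho i.
Proof.
rewrite /rho_ ltr0q; have : range q (q (tau2 i)) by exists (tau2 i).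
by rewrite q_onto.
Qed.

Lemma pseudocompact_basis_basis : is_basis (pseudocompact_open X) B.
Proof.
split=> [_ [i _ <-]|U /pseudocompact_openP[oU bU]].
  apply/pseudocompact_openP.
  have -> : Some @^-1` B i = [set x | if odd i then rho i./2 < mdist x (lam i./2)
      else mdist x (lam i./2) < rho i./2].
    by apply/seteqP; split=> x /pseudocompact_basis_Some.
  split; first by case: (odd i); [exact: mdist_open_gt|exact: mdist_open_lt].
  move=> /pseudocompact_basis_None ->.
  (* Adding 1 fits the closed ball into an open one. *)
  exists (lam i./2), (rho i./2 + 1) => x /=.
  by rewrite ballEmdist /= metric_sym => /negP; rewrite -leNgt; lra.
exists [set i | B i `<=` U]; apply/seteqP; split=> [[y|] Uy|y [i]]; last exact.
- move: oU; rewrite openE => /(_ y Uy) /nbhs_ballP[e /= e0 eU].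
  (* A ball of radius below [e / 2] that contains [y] lies within distance [e] of [y]. *)
  have [|i [yi ie]] := @ex_small_rational_ball y (e / 2); first lra.
  exists i.*2 => /=; last first.
    by apply/pseudocompact_basis_Some; rewrite odd_double doubleK.
  move=> [z /pseudocompact_basis_Some|/pseudocompact_basis_None].
    rewrite odd_double doubleK => zi; apply: eU; rewrite ballEmdist /=.
    by have := metric_triangle y (lam i) z; rewrite (metric_sym (lam i) z); lra.
  by rewrite odd_double.
(* Around infinity: the complement of [U] lies in a ball, and a rational ball containing that ball
   has its exterior inside [U]. *)
- have [x [r xr]] := bU Uy; have [i xi] := ex_large_rational_ball x r.
  exists i.*2.+1; last by apply/pseudocompact_basis_None; rewrite /= odd_double.
  move=> [z /pseudocompact_basis_Some|//].
  rewrite /= odd_double /= uphalf_double => zi; apply: contrapT => Uz.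
  have := xr _ Uz; rewrite ballEmdist /= => xz.
  by have := metric_triangle z x (lam i); rewrite (metric_sym z x); lra.
Qed.

(** * Formal inclusion and formal disjointness *)

Definition ball_incl i j := mdist (lam i) (lam j) + rho i < rho j.
Definition ball_disj i j := rho i + rho j < mdist (lam i) (lam j).

(** Odd indices stand for exteriors of closed balls, so inclusion between two of them is reversed.
    An exterior contains infinity and is never included in a ball, hence [odd j] in the first
    branch. *)
Definition basis_incl i j :=
  if odd i then odd j && ball_incl j./2 i./2
  else if odd j then ball_disj i./2 j./2 else ball_incl i./2 j./2.

(** A ball misses an exterior when it is formally included in the removed ball. Two exteriors share
    infinity, hence [~~ odd j]. *)
Definition basis_disj i j :=
  if odd i then ~~ odd j && ball_incl j./2 i./2
  else if odd j then ball_incl i./2 j./2 else ball_disj i./2 j./2.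

Lemma basis_inclP i j : basis_incl i j -> B i `<=` B j.
Proof.
rewrite /basis_incl /ball_incl /ball_disj => ij [x|].
  move=> /pseudocompact_basis_Some xi; apply/pseudocompact_basis_Some.
  (* One triangle inequality for each side of the triangle formed by [x] and the two centres; every
     parity case is then linear. *)
  have := metric_triangle x (lam i./2) (lam j./2).
  have := metric_triangle x (lam j./2) (lam i./2).
  have := metric_triangle (lam i./2) x (lam j./2).
  rewrite (metric_sym (lam j./2)) (metric_sym (lam i./2) x).
  move: ij xi; rewrite (metric_sym (lam j./2)).
  by case: (odd i) (odd j) => [] [] //=; lra.
move=> /pseudocompact_basis_None oi; apply/pseudocompact_basis_None.
by move: ij; rewrite oi => /andP[].
Qed.

Lemma basis_disjP i j : basis_disj i j -> B i `&` B j = set0.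
Proof.
rewrite /basis_disj /ball_incl /ball_disj => ij; apply/seteqP; split=> // -[x|] [].
  move=> /pseudocompact_basis_Some xi /pseudocompact_basis_Some.
  have := metric_triangle x (lam i./2) (lam j./2).
  have := metric_triangle x (lam j./2) (lam i./2).
  have := metric_triangle (lam i./2) x (lam j./2).
  rewrite (metric_sym (lam j./2)) (metric_sym (lam i./2) x).
  move: ij xi; rewrite (metric_sym (lam j./2)).
  by case: (odd i) (odd j) => [] [] //=; lra.
move=> /pseudocompact_basis_None oi /pseudocompact_basis_None oj.
by move: ij; rewrite oi oj.
Qed.

Lemma ex_basis_disj (x y : option X) : x <> y ->
  exists i j, [/\ B i x, B j y & basis_disj i j].
Proof.
have finite_infinite (z : X) :
    exists i j, [/\ B i.*2 (Some z), B j.*2.+1 None & ball_incl i j].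
  have [i [zi _]] := ex_small_rational_ball z ltr01.
  (* With [M] equal to the radius of the small ball, the bound is literally formal inclusion in ball
     [j], whose exterior separates infinity from [z]. *)
  have [j ij] := ex_large_rational_ball (lam i) (rho i).
  exists i, j; split=> //; last by rewrite pseudocompact_basis_None /= odd_double.
  by rewrite pseudocompact_basis_Some odd_double doubleK.
case: x y => [x|] [y|] // xy.
- have d0 : 0 < mdist x y by rewrite mdist_gt0; apply/eqP => xyE; rewrite xyE in xy.
  (* With radii below a quarter of [mdist x y], the centres stay more than half of it apart, while
     the radii sum to less than half. *)
  have [|i [xi ie]] := @ex_small_rational_ball x (mdist x y / 4); first lra.
  have [|j [yj je]] := @ex_small_rational_ball y (mdist x y / 4); first lra.
  exists i.*2, j.*2; split; rewrite ?pseudocompact_basis_Some ?odd_double ?doubleK//.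
  rewrite /basis_disj !odd_double !doubleK /ball_disj.
  have := metric_triangle x (lam i) y; have := metric_triangle (lam i) (lam j) y.
  by rewrite (metric_sym (lam j) y); lra.
- have [i [j [xi Nj ij]]] := finite_infinite x.
  exists i.*2, j.*2.+1; split=> //.
  by rewrite /basis_disj /= !odd_double doubleK /= uphalf_double.
- have [i [j [xi Nj ij]]] := finite_infinite y.
  exists j.*2.+1, i.*2; split=> //.
  by rewrite /basis_disj /= !odd_double doubleK /= uphalf_double.
Qed.

Lemma ex_basis_incl (x : option X) i j : B i x -> B j x ->
  exists k, [/\ B k x, basis_incl k i & basis_incl k j].
Proof.
case: x => [x|].
  (* Every small enough ball around [x] is formally included in [B i']. The bound is half the slack
     at [x], since such a ball spends its radius twice: moving from [x] to its centre, and as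
     radius. *)
  have margin i' : B i' (Some x) -> exists2 e, 0 < e &
      forall k, mdist x (lam k) < rho k -> rho k < e -> basis_incl k.*2 i'.
    move=> /pseudocompact_basis_Some xi.
    exists (`|rho i'./2 - mdist x (lam i'./2)| / 2).
      rewrite divr_gt0// normr_gt0 subr_eq0; apply/eqP => E.
      by move: xi; rewrite E ltxx; case: ifP.
    move=> k xk; rewrite /basis_incl odd_double doubleK /ball_disj /ball_incl.
    case: (odd i') xi => xi.
      rewrite ltr0_norm ?subr_lt0// => ke.
      by have := metric_triangle x (lam k) (lam i'./2); lra.
    rewrite gtr0_norm ?subr_gt0// => ke.
    have := metric_triangle (lam k) x (lam i'./2).
    by rewrite (metric_sym (lam k) x); lra.
  move=> /margin[e e0 He] /margin[e' e'0 He'].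
  have [|k [xk]] := @ex_small_rational_ball x (Num.min e e').
    by rewrite lt_min e0 e'0.
  rewrite lt_min => /andP[ke ke']; exists k.*2; split; [|exact: He|exact: He'].
  by rewrite pseudocompact_basis_Some odd_double doubleK.
move=> /pseudocompact_basis_None oi /pseudocompact_basis_None oj.
(* The margin contains both radii and the distance between centres, so ball [k] formally includes
   both removed balls; taking exteriors reverses this. *)
have [k kP] := ex_large_rational_ball (lam i./2)
  (rho i./2 + rho j./2 + mdist (lam i./2) (lam j./2)).
exists k.*2.+1; rewrite /basis_incl /= odd_double /= oi oj uphalf_double /ball_incl.
have := metric_triangle (lam j./2) (lam i./2) (lam k).
rewrite (metric_sym (lam j./2) (lam i./2)).
have := mdist_ge0 (lam i./2) (lam j./2).
have := rho_gt0 i./2; have := rho_gt0 j./2.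
split; [by rewrite pseudocompact_basis_None /= odd_double|lra|lra].
Qed.

End basis.

(** * Computable enumerability *)

Section enumerability.
Variables (R : realType) (X : metricType R) (alpha : nat -> X) (q : nat -> rat).
Variables (tau1 tau2 : nat -> nat) (F : 3.-tuple nat -> rat).
Hypothesis q_comp : computable_rat q.
Hypothesis tau1_comp : computable_nat tau1.
Hypothesis tau2_comp : computable_nat tau2.
Hypothesis tau_onto : range (fun i : nat => (tau1 i, tau2 i)) = [set: nat * nat].
Hypothesis F_comp : computable_ratfun F.
Hypothesis F_approx : forall i j k : nat,
  `|mdist (alpha i) (alpha j) - ratr (F [tuple i; j; k])| < 2 ^- k.

Let incl_test i j k :=
  0 < (q (tau2 j) - q (tau2 i)) - F [tuple tau1 i; tau1 j; k] - 2 ^- k.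
Let disj_test i j k :=
  0 < F [tuple tau1 i; tau1 j; k] - (q (tau2 i) + q (tau2 j)) - 2 ^- k.

(** With both radii on one side, the relation compares an approximable distance with a rational
    number. *)
Lemma ball_inclP i j :
  ball_incl alpha q tau1 tau2 i j <-> exists k, incl_test i j k.
Proof.
rewrite /ball_incl -ltrBrDr -rmorphB.
exact: (approx_ltP _ (F_approx _ _)).
Qed.

Lemma ball_disjP i j :
  ball_disj alpha q tau1 tau2 i j <-> exists k, disj_test i j k.
Proof.
rewrite /ball_disj -rmorphD.
exact: (approx_gtP _ (F_approx _ _)).
Qed.

Lemma recursive_incl_test n (f g h : n.-tuple nat -> nat) :
  recursive f -> recursive g -> recursive h ->
  recursive_bool (fun v => incl_test (f v) (g v) (h v)).
Proof.
move=> rf rg rh; apply: recursive_rat_gt0.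
apply: recursive_ratD; last exact/recursive_ratN/recursive_rat_exp2V.
apply: recursive_ratD; last first.
  by apply/recursive_ratN/recursive_rat_app3 => //; exact: recursive_app1.
apply: recursive_ratD; [|apply: recursive_ratN];
  by apply: recursive_rat_app1 => //; exact: recursive_app1.
Qed.

Lemma recursive_disj_test n (f g h : n.-tuple nat -> nat) :
  recursive f -> recursive g -> recursive h ->
  recursive_bool (fun v => disj_test (f v) (g v) (h v)).
Proof.
move=> rf rg rh; apply: recursive_rat_gt0.
apply: recursive_ratD; last exact/recursive_ratN/recursive_rat_exp2V.
apply: recursive_ratD.
  by apply: recursive_rat_app3 => //; exact: recursive_app1.
apply/recursive_ratN/recursive_ratD;
  by apply: recursive_rat_app1 => //; exact: recursive_app1.
Qed.

Let I0 : 'I_3 := ord0.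
Let I1 : 'I_3 := lift ord0 ord0.
Let I2 : 'I_3 := ord_max.

Let odd0 : @recursive_bool 3 (fun v => odd (tnth v I0)).
Proof. exact/recursive_odd/rec_proj. Qed.

Let odd1 : @recursive_bool 3 (fun v => odd (tnth v I1)).
Proof. exact/recursive_odd/rec_proj. Qed.

Let half0 : @recursive 3 (fun v => (tnth v I0)./2).
Proof. exact/recursive_half/rec_proj. Qed.

Let half1 : @recursive 3 (fun v => (tnth v I1)./2).
Proof. exact/recursive_half/rec_proj. Qed.

(** The parity split does not involve the precision, so a single existential over [k] can be pulled
    out of all cases, leaving a decidable relation on triples. *)
Lemma ce2_basis_incl :
  ce2 [set ij | basis_incl alpha q tau1 tau2 ij.1 ij.2].
Proof.
pose P (v : 3.-tuple nat) :=
  let i := tnth v I0 in let j := tnth v I1 in let k := tnth v I2 in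
  if odd i then odd j && incl_test j./2 i./2 k
  else if odd j then disj_test i./2 j./2 k else incl_test i./2 j./2 k.
have rP : recursive_bool P.
  apply: recursive_bool_if => //.
    by apply: recursive_boolI => //; apply: recursive_incl_test => //; exact: rec_proj.
  apply: recursive_bool_if => //.
    by apply: recursive_disj_test => //; exact: rec_proj.
  by apply: recursive_incl_test => //; exact: rec_proj.
suff -> : [set ij | basis_incl alpha q tau1 tau2 ij.1 ij.2] =
    [set ij | exists k, P [tuple ij.1; ij.2; k]] by exact: ce2_exists tau_onto rP.
apply/funext => -[i j] /=; apply/propext; rewrite /basis_incl /P /tnth /=.
case: (odd i) (odd j) => [] [] /=; [exact: ball_inclP| |exact: ball_disjP|exact: ball_inclP].
by split=> [|[]].
Qed.

Lemma ce2_basis_disj :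
  ce2 [set ij | basis_disj alpha q tau1 tau2 ij.1 ij.2].
Proof.
pose P (v : 3.-tuple nat) :=
  let i := tnth v I0 in let j := tnth v I1 in let k := tnth v I2 in
  if odd i then ~~ odd j && incl_test j./2 i./2 k
  else if odd j then incl_test i./2 j./2 k else disj_test i./2 j./2 k.
have rP : recursive_bool P.
  apply: recursive_bool_if => //.
    apply: recursive_boolI; first exact: recursive_boolN.
    by apply: recursive_incl_test => //; exact: rec_proj.
  apply: recursive_bool_if => //.
    by apply: recursive_incl_test => //; exact: rec_proj.
  by apply: recursive_disj_test => //; exact: rec_proj.
suff -> : [set ij | basis_disj alpha q tau1 tau2 ij.1 ij.2] =
    [set ij | exists k, P [tuple ij.1; ij.2; k]] by exact: ce2_exists tau_onto rP.
apply/funext => -[i j] /=; apply/propext; rewrite /basis_disj /P /tnth /=.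
case: (odd i) (odd j) => [] [] /=; [|exact: ball_inclP..|exact: ball_disjP].
by split=> [|[]].
Qed.

End enumerability.

Theorem theorem8p3 (R : realType) (X : metricType R) (alpha : nat -> X)
    (q : nat -> rat) (tau1 tau2 : nat -> nat)
    (hX : computable_metric_space alpha)
    (hq : computable_rat q) (hq_onto : range q = [set r : rat | 0 < r])
    (htau1 : computable_nat tau1) (htau2 : computable_nat tau2)
    (htau_onto : range (fun i : nat => (tau1 i, tau2 i)) = [set: nat * nat]) :
  computable_topological_space (pseudocompact_open X)
    (pseudocompact_basis alpha q tau1 tau2).
Proof.
have [alpha_dense [F [F_comp F_approx]]] := hX.
split.
- exact: pseudocompact_open_topology (alpha 0%N).
- exact: pseudocompact_basis_basis.
exists [set ij | basis_incl alpha q tau1 tau2 ij.1 ij.2],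
  [set ij | basis_disj alpha q tau1 tau2 ij.1 ij.2]; split; split.
- exact: (ce2_basis_incl hq htau1 htau2 htau_onto F_comp F_approx).
- exact: (ce2_basis_disj hq htau1 htau2 htau_onto F_comp F_approx).
- by move=> i j /basis_disjP.
- by move=> i j /basis_inclP.
- by move=> x y xy; exact: ex_basis_disj.
- by move=> x i j; exact: ex_basis_incl.
Qed.
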